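(* For real $\nu$ let $g_\nu(u)=K_\nu'(u)/K_\nu(u)^2$, $u>0$. Then $g_\nu$ is strictly decreasing on $(0,\infty)$ if and only if $|\nu|\ge1$. For $|\nu|<1$, $g_\nu$ is increasing near $0$ (on some interval $(0,\delta)$ with $\delta>0$) and decreasing near $\infty$ (on some interval $(M,\infty)$), hence is not monotone on $(0,\infty)$.
   Context: $K_\nu$ is the modified Bessel function of the second kind of order $\nu$, with the standard normalization: $K_\nu(u)>0$ for $u>0$, $K_{-\nu}=K_\nu$, $K_\nu$ solves $u^2w''+uw'-(u^2+\nu^2)w=0$, and $K_\nu(u)\sim(\pi/(2u))^{1/2}e^{-u}$ as $u\to\infty$. The prime denotes the derivative in $u$. *)

(* Defs.v *)
From Stdlib Require Import Reals.
From Coquelicot Require Import Coquelicot.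
Open Scope R_scope.

(* [K nu u] is K_nu(u). The equation and the behaviour at infinity already
   determine each [K nu] on (0, +oo), because every solution independent of
   K_nu grows exponentially; values at u <= 0 are unconstrained.
   Differentiability is explicit because Coquelicot's [Derive] is total. *)
Record is_besselK (K : R -> R -> R) : Prop := {
  besselK_pos : forall nu u, 0 < u -> 0 < K nu u;
  besselK_opp : forall nu u, 0 < u -> K (- nu) u = K nu u;
  besselK_ex_derive : forall nu u, 0 < u -> ex_derive (K nu) u;
  besselK_ex_derive2 : forall nu u, 0 < u -> ex_derive (Derive (K nu)) u;
  besselK_ode : forall nu u, 0 < u ->
    u ^ 2 * Derive (Derive (K nu)) u + u * Derive (K nu) u
      - (u ^ 2 + nu ^ 2) * K nu u = 0;
  besselK_equiv_infty : forall nu,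
    is_lim (fun u => K nu u / (sqrt (PI / (2 * u)) * exp (- u))) p_infty 1
}.

Definition g (K : R -> R -> R) (nu u : R) : R :=
  Derive (K nu) u / (K nu u) ^ 2.

Definition strictly_increasing_on (D : R -> Prop) (f : R -> R) : Prop :=
  forall x y, D x -> D y -> x < y -> f x < f y.

Definition strictly_decreasing_on (D : R -> Prop) (f : R -> R) : Prop :=
  forall x y, D x -> D y -> x < y -> f y < f x.

Definition monotone_on (D : R -> Prop) (f : R -> R) : Prop :=
  (forall x y, D x -> D y -> x <= y -> f x <= f y) \/
  (forall x y, D x -> D y -> x <= y -> f y <= f x).

(* Main.v *)
Require Import Defs.
From Stdlib Require Import Reals Lra.
From Coquelicot Require Import Coquelicot.
Open Scope R_scope.

(** Write [w] for K_nu and let [y = - u w' / w] be its logarithmic slope. The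
    Bessel equation turns into the Riccati equation
      [u y' = y^2 - u^2 - nu^2],
    and the derivative of [g = w' / w^2] becomes
      [g' = (u^2 + nu^2 + y - 2 y^2) / (u^2 w)],
    so that everything reduces to locating [y] with respect to the positive
    root of [2 y^2 - y = u^2 + nu^2].

    The key estimate is [y^2 > u^2 + nu^2] for every [u > 0]
    ([log_slope_sqr_gt]); by the Riccati equation it also says that [y]
    increases. If it failed at one point, it would fail from there on, because
    [(u w')^2 - (u^2 + nu^2) w^2] has derivative [- 2 u w^2]; then [y] would
    be bounded above and the Riccati equation would drive it to minus
    infinity, whereas [y > 0] because [w] decreases.

    Where [u^2 + nu^2 >= 1] the estimate gives [y > 1], and
    [2 y^2 - y - u^2 - nu^2 = (y^2 - u^2 - nu^2) + y (y - 1) > 0], so [g]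
    decreases there: on the whole half-line if [|nu| >= 1], and always
    beyond 1.

    At the origin [y] tends to [|nu|], since any larger limit would make [y']
    at least a multiple of [1 / u], which is not integrable at 0
    ([log_slope_lt_near_0]). If [|nu| < 1], then [2 y^2 - y < nu^2] for [y]
    slightly above [|nu|], and [g] increases near 0. *)

(** * Strict monotonicity from the sign of a derivative *)

Lemma mean_value (f df : R -> R) (a b : R) :
  a < b -> (forall x, a <= x <= b -> is_derive f x (df x)) ->
  exists c, a < c < b /\ f b - f a = df c * (b - a).
Proof.
intros Hab Hf.
destruct (MVT_cor2 f df a b Hab) as (c & E & Hc).
- intros x Hx; apply is_derive_Reals; auto.
- now exists c.
Qed.

Lemma lt_of_derive_pos (f df : R -> R) (a b : R) :
  a < b -> (forall x, a <= x <= b -> is_derive f x (df x)) ->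
  (forall x, a < x < b -> 0 < df x) -> f a < f b.
Proof.
intros Hab Hf Hpos.
destruct (mean_value f df a b Hab Hf) as (c & Hc & E).
specialize (Hpos c Hc); nra.
Qed.

Lemma lt_of_derive_neg (f df : R -> R) (a b : R) :
  a < b -> (forall x, a <= x <= b -> is_derive f x (df x)) ->
  (forall x, a < x < b -> df x < 0) -> f b < f a.
Proof.
intros Hab Hf Hneg.
destruct (mean_value f df a b Hab Hf) as (c & Hc & E).
specialize (Hneg c Hc); nra.
Qed.

(** * Decaying solutions of the modified Bessel equation *)

(** The last field only says that [w] is not bounded away from 0 near
    infinity. This suffices because every positive solution that is not a
    multiple of K_nu grows exponentially. *)
Record decaying_solution (nu : R) (w : R -> R) : Prop := {
  sol_pos : forall u, 0 < u -> 0 < w u;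
  sol_derive : forall u, 0 < u -> is_derive w u (Derive w u);
  sol_derive2 : forall u, 0 < u ->
    is_derive (Derive w) u
      ((1 + nu ^ 2 / u ^ 2) * w u - Derive w u / u);
  sol_small : forall c a, 0 < c -> exists u, a < u /\ w u < c
}.

(** Eventually [w u < 2 sqrt (pi / (2 u)) exp (- u) <= 2 exp (- u) < 2 / u],
    which falls below any [c > 0]. *)
Lemma besselK_decaying (K : R -> R -> R) (HK : is_besselK K) (nu : R) :
  decaying_solution nu (K nu).
Proof.
split.
- intros u Hu; now apply (besselK_pos K HK).
- intros u Hu; now apply Derive_correct, (besselK_ex_derive K HK).
- intros u Hu.
  replace (_ - _) with (Derive (Derive (K nu)) u).
  + now apply Derive_correct, (besselK_ex_derive2 K HK).
  + generalize (besselK_ode K HK nu u Hu); intros E.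
    apply Rmult_eq_reg_l with (u ^ 2).
    * apply Rminus_diag_uniq; rewrite <- E; field; lra.
    * apply pow_nonzero; lra.
- intros c a Hc.
  destruct (proj2 (is_lim_spec _ _ _) (besselK_equiv_infty K HK nu)
              (mkposreal 1 Rlt_0_1)) as [M HM]; simpl in HM.
  set (u := Rmax (Rmax (M + 1) (a + 1)) (Rmax 2 (2 / c))).
  assert (M + 1 <= u /\ a + 1 <= u /\ 2 <= u /\ 2 / c <= u)
    as (H1 & H2 & H3 & H4).
  { unfold u; repeat split;
      eauto using Rle_trans, Rmax_l, Rmax_r. }
  exists u; split; [lra|].
  specialize (HM u ltac:(lra)).
  apply Rabs_def2 in HM; destruct HM as [HM _].
  assert (Hs1 : sqrt (PI / (2 * u)) <= 1).
  { rewrite <- sqrt_1; apply sqrt_le_1_alt.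
    apply Rle_div_l; [lra|]; generalize PI_4; lra. }
  assert (Hs0 : 0 < sqrt (PI / (2 * u))).
  { apply sqrt_lt_R0, Rdiv_lt_0_compat; [apply PI_RGT_0|lra]. }
  assert (He : 0 < exp (- u)) by apply exp_pos.
  assert (He1 : exp (- u) * u < 1).
  { apply Rlt_le_trans with (exp (- u) * exp u).
    - apply Rmult_lt_compat_l; [exact He|].
      generalize (exp_ineq1 u ltac:(lra)); lra.
    - rewrite <- exp_plus, Rplus_opp_l, exp_0; lra. }
  apply (Rle_div_l 2 u c Hc) in H4.
  set (e := exp (- u)) in *; set (s := sqrt _) in *.
  assert (Hse : 0 < s * e) by now apply Rmult_lt_0_compat.
  assert (HKu : K nu u < 2 * (s * e)).
  { apply Rlt_div_l; [exact Hse|lra]. }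
  apply Rlt_le_trans with (1 := HKu).
  assert (s * e <= e) by nra.
  assert (2 * e <= c) by nra.
  lra.
Qed.

(** * The logarithmic slope *)

Definition log_slope (w : R -> R) (u : R) : R := - (u * Derive w u / w u).

(** The equation says [(u w')' = (u + nu^2 / u) w > 0]: once [w'] is
    nonnegative, it remains so and [w] cannot become small. *)
Lemma sol_derive_neg (nu : R) (w : R -> R) (Hw : decaying_solution nu w)
  (u : R) : 0 < u -> Derive w u < 0.
Proof.
intros Hu; apply Rnot_le_lt; intros Hd.
assert (Hpos : forall x, u < x -> 0 < Derive w x).
{ intros x Hx.
  assert (H : u * Derive w u < x * Derive w x).
  { apply (lt_of_derive_pos (fun t => t * Derive w t)
             (fun t => (t + nu ^ 2 / t) * w t)); [exact Hx| |].
    - intros t Ht; assert (0 < t) by lra.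
      generalize (sol_derive2 nu w Hw t ltac:(lra)); intros D2.
      evar_last.
      { apply (is_derive_mult (fun t => t) (Derive w) t);
          [apply is_derive_id|exact D2|apply Rmult_comm]. }
      unfold plus, mult, one; simpl; field; lra.
    - intros t Ht; apply Rmult_lt_0_compat; [|apply (sol_pos nu w Hw); lra].
      apply Rplus_lt_le_0_compat; [lra|].
      apply Rdiv_le_0_compat; [apply pow2_ge_0|lra]. }
  assert (0 <= u * Derive w u) by (apply Rmult_le_pos; lra).
  apply Rmult_lt_reg_l with x; lra. }
destruct (sol_small nu w Hw (w u) u (sol_pos nu w Hw u Hu)) as (v & Huv & Hv).
assert (w u < w v); [|lra].
apply lt_of_derive_pos with (Derive w); [exact Huv| |].
- intros x Hx; apply (sol_derive nu w Hw); lra.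
- intros x Hx; apply Hpos; lra.
Qed.

Lemma log_slope_pos (nu : R) (w : R -> R) (Hw : decaying_solution nu w)
  (u : R) : 0 < u -> 0 < log_slope w u.
Proof.
intros Hu; unfold log_slope.
generalize (sol_derive_neg nu w Hw u Hu) (sol_pos nu w Hw u Hu); intros H1 H2.
replace (- _) with (u * (- Derive w u) / w u) by (field; lra).
apply Rdiv_lt_0_compat; [|exact H2].
apply Rmult_lt_0_compat; lra.
Qed.

Lemma log_slope_riccati (nu : R) (w : R -> R) (Hw : decaying_solution nu w)
  (u : R) :
  0 < u ->
  is_derive (log_slope w) u ((log_slope w u ^ 2 - u ^ 2 - nu ^ 2) / u).
Proof.
intros Hu.
generalize (sol_derive nu w Hw u Hu) (sol_derive2 nu w Hw u Hu)
  (sol_pos nu w Hw u Hu); intros D1 D2 Hp.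
unfold log_slope at 1.
evar_last.
{ apply (is_derive_opp (fun u => u * Derive w u / w u)).
  apply is_derive_div; [|exact D1|lra].
  apply (is_derive_mult (fun t => t) (Derive w) u);
    [apply is_derive_id|exact D2|apply Rmult_comm]. }
unfold log_slope, opp, plus, mult, one; simpl; field; lra.
Qed.

(** The numerator of the Riccati equation times [w ^ 2]; the factor [w ^ 2]
    integrates the linear equation that this numerator satisfies. *)
Lemma energy_derive (nu : R) (w : R -> R) (Hw : decaying_solution nu w)
  (u : R) :
  0 < u ->
  is_derive (fun t => (t * Derive w t) ^ 2 - (t ^ 2 + nu ^ 2) * w t ^ 2) u
    (- (2 * u * w u ^ 2)).
Proof.
intros Hu.
generalize (sol_derive nu w Hw u Hu) (sol_derive2 nu w Hw u Hu);
  intros D1 D2.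
assert (E1 := is_derive_unique _ _ _ D1).
assert (E2 := is_derive_unique _ _ _ D2).
auto_derive.
- repeat split; eexists; eassumption.
- change (fun x => w x) with w.
  replace (Derive (fun x => Derive w x) u) with
    ((1 + nu ^ 2 / u ^ 2) * w u - Derive w u / u) by now symmetry.
  field; lra.
Qed.

Lemma energy_log_slope (nu : R) (w : R -> R) (u : R) :
  0 < w u ->
  (u * Derive w u) ^ 2 - (u ^ 2 + nu ^ 2) * w u ^ 2
  = (log_slope w u ^ 2 - u ^ 2 - nu ^ 2) * w u ^ 2.
Proof. intros Hp; unfold log_slope; field; lra. Qed.

(** The curve [y^2 = u^2 + nu^2] is a one-way barrier for the Riccati
    equation, and the trajectories below it reach 0 in finite time. *)
Lemma log_slope_sqr_gt (nu : R) (w : R -> R) (Hw : decaying_solution nu w)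
  (u : R) : 0 < u -> u ^ 2 + nu ^ 2 < log_slope w u ^ 2.
Proof.
intros Hu; apply Rnot_le_lt; intros Hle.
set (y := log_slope w) in *.
assert (Hneg : forall x, u < x -> y x ^ 2 - x ^ 2 - nu ^ 2 < 0).
{ intros x Hx.
  generalize (sol_pos nu w Hw u Hu) (sol_pos nu w Hw x ltac:(lra));
    intros Pu Px.
  assert (H := lt_of_derive_neg _ (fun t => - (2 * t * w t ^ 2)) u x Hx
            (fun t Ht => energy_derive nu w Hw t ltac:(lra))).
  cbv beta in H.
  rewrite !energy_log_slope in H by assumption; fold y in H.
  assert (Hlt := H ltac:(intros t Ht;
    assert (0 < w t) by (apply (sol_pos nu w Hw); lra);
    assert (0 < 2 * t * w t ^ 2) by
      (apply Rmult_lt_0_compat; [lra|apply pow_lt; assumption]); lra)).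
  clear H.
  assert (0 < w u ^ 2) by now apply pow_lt.
  assert (0 < w x ^ 2) by now apply pow_lt.
  nra. }
assert (Hdec : forall x, u < x -> y x < y u).
{ intros x Hx.
  apply lt_of_derive_neg with (fun t => (y t ^ 2 - t ^ 2 - nu ^ 2) / t);
    [exact Hx| |].
  - intros t Ht; apply (log_slope_riccati nu w Hw); lra.
  - intros t Ht; apply Rdiv_neg_pos; [apply Hneg|]; lra. }
assert (Pu : 0 < y u) by now apply (log_slope_pos nu w Hw).
(* Beyond [u + y u + 1] the slope [y] has derivative at most -1. *)
set (a := u + y u + 1).
destruct (mean_value y (fun t => (y t ^ 2 - t ^ 2 - nu ^ 2) / t) a (a + y u))
  as (c & Hc & E).
- lra.
- intros t Ht; apply (log_slope_riccati nu w Hw); unfold a in *; lra.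
- assert (Hca : u + y u + 1 < c) by (unfold a in *; lra).
  assert (Pc : 0 < y c) by (apply (log_slope_pos nu w Hw); lra).
  assert (Pa : 0 < y (a + y u))
    by (apply (log_slope_pos nu w Hw); unfold a; lra).
  assert (Hya := Hdec a ltac:(unfold a; lra)).
  assert (Hyc := Hdec c ltac:(lra)).
  assert (Hd : (y c ^ 2 - c ^ 2 - nu ^ 2) / c <= -1).
  { apply Rle_div_l; [lra|]. nra. }
  nra.
Qed.

Lemma log_slope_gt_abs (nu : R) (w : R -> R) (Hw : decaying_solution nu w)
  (u : R) : 0 < u -> Rabs nu < log_slope w u.
Proof.
intros Hu.
generalize (log_slope_sqr_gt nu w Hw u Hu) (log_slope_pos nu w Hw u Hu).
rewrite <- (pow2_abs nu); generalize (Rabs_pos nu); intros; nra.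
Qed.

Lemma log_slope_increasing (nu : R) (w : R -> R)
  (Hw : decaying_solution nu w) (a b : R) :
  0 < a -> a < b -> log_slope w a < log_slope w b.
Proof.
intros Ha Hab.
apply (lt_of_derive_pos _ _ a b Hab
         (fun t Ht => log_slope_riccati nu w Hw t ltac:(lra))).
intros t Ht; apply Rdiv_lt_0_compat; [|lra].
generalize (log_slope_sqr_gt nu w Hw t ltac:(lra)); lra.
Qed.

(** A positive function cannot have a derivative of size [c / u] down to 0,
    and [y >= Y > |nu|] would make [u y'] at least [c] below [sqrt c]. *)
Lemma log_slope_lt_near_0 (nu : R) (w : R -> R)
  (Hw : decaying_solution nu w) (Y : R) :
  Rabs nu < Y ->
  exists d, 0 < d /\ forall u, 0 < u < d -> log_slope w u < Y.
Proof.
intros HY.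
set (y := log_slope w); set (c := (Y ^ 2 - nu ^ 2) / 2).
assert (Hc : 0 < c).
{ unfold c; rewrite <- (pow2_abs nu); generalize (Rabs_pos nu); nra. }
set (s := sqrt c).
assert (Hs : 0 < s) by now apply sqrt_lt_R0.
assert (Hs2 : s ^ 2 = c) by (apply pow2_sqrt; lra).
assert (Ps : 0 < y s) by now apply (log_slope_pos nu w Hw).
(* The logarithmic lower bound for [y s - y d] exceeds [y s] at this [d]. *)
set (d := s * exp (- (y s / c))).
assert (Hq : 0 < y s / c) by now apply Rdiv_lt_0_compat.
assert (Hd : 0 < d) by (apply Rmult_lt_0_compat; [exact Hs|apply exp_pos]).
assert (Hds : d < s).
{ assert (exp (- (y s / c)) < 1).
  { rewrite <- exp_0; apply exp_increasing; lra. }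
  unfold d; nra. }
exists d; split; [exact Hd|].
assert (Pd : 0 < y d) by now apply (log_slope_pos nu w Hw).
assert (HdY : y d < Y).
{ apply Rnot_le_lt; intros HYd.
  assert (H : y d - c * ln d < y s - c * ln s).
  { apply (lt_of_derive_pos (fun t => y t - c * ln t)
       (fun t => (y t ^ 2 - t ^ 2 - nu ^ 2) / t - c * / t)); [exact Hds| |].
    - intros t Ht; assert (0 < t) by lra.
      apply (is_derive_minus y (fun t => c * ln t)).
      + now apply (log_slope_riccati nu w Hw).
      + apply is_derive_scal, is_derive_ln; lra.
    - intros t Ht; assert (0 < t) by lra.
      assert (Y < y t).
      { apply Rle_lt_trans with (1 := HYd).
        now apply (log_slope_increasing nu w Hw). }
      replace (_ - _) with ((y t ^ 2 - t ^ 2 - nu ^ 2 - c) / t)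
        by (field; lra).
      apply Rdiv_lt_0_compat; [|lra].
      assert (t ^ 2 < s ^ 2) by nra.
      assert (Y ^ 2 < y t ^ 2) by (generalize (Rabs_pos nu); nra).
      assert (Y ^ 2 - nu ^ 2 = 2 * c) by (unfold c; field).
      lra. }
  assert (E : c * ln d = c * ln s - y s).
  { unfold d; rewrite ln_mult, ln_exp by (assumption || apply exp_pos).
    field; lra. }
  lra. }
intros u Hu.
apply Rlt_trans with (2 := HdY), (log_slope_increasing nu w Hw); lra.
Qed.

(** * Monotonicity of w' / w^2 *)

Lemma derive_ratio (nu : R) (w : R -> R) (Hw : decaying_solution nu w)
  (u : R) :
  0 < u ->
  is_derive (fun t => Derive w t / w t ^ 2) u
    ((u ^ 2 + nu ^ 2 + log_slope w u - 2 * log_slope w u ^ 2)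
       / (u ^ 2 * w u)).
Proof.
intros Hu.
generalize (sol_derive nu w Hw u Hu) (sol_derive2 nu w Hw u Hu)
  (sol_pos nu w Hw u Hu); intros D1 D2 Hp.
evar_last.
{ apply is_derive_div; [exact D2| |apply pow_nonzero; lra].
  apply is_derive_pow, D1. }
unfold log_slope; simpl; field; lra.
Qed.

Lemma ratio_decreasing (nu : R) (w : R -> R) (Hw : decaying_solution nu w)
  (a b : R) :
  0 < a -> 1 <= a ^ 2 + nu ^ 2 -> a < b ->
  Derive w b / w b ^ 2 < Derive w a / w a ^ 2.
Proof.
intros Ha H1 Hab.
apply (lt_of_derive_neg _ _ a b Hab
         (fun t Ht => derive_ratio nu w Hw t ltac:(lra))).
intros t Ht; assert (Pt : 0 < t) by lra.
generalize (log_slope_sqr_gt nu w Hw t Pt) (log_slope_pos nu w Hw t Pt)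
  (sol_pos nu w Hw t Pt); intros Hy Py Pw.
apply Rdiv_neg_pos.
- assert (a ^ 2 < t ^ 2) by nra.
  assert (1 < log_slope w t) by nra.
  nra.
- apply Rmult_lt_0_compat; [now apply pow_lt|exact Pw].
Qed.

Lemma ratio_increasing_near_0 (nu : R) (w : R -> R)
  (Hw : decaying_solution nu w) :
  Rabs nu < 1 ->
  exists d, 0 < d /\ forall a b, 0 < a -> a < b -> b < d ->
    Derive w a / w a ^ 2 < Derive w b / w b ^ 2.
Proof.
intros Hnu.
(* The point a quarter of the way from [|nu|] to 1 is a value [Y] at which
   [2 Y^2 - Y - nu^2 = - (1 - nu^2) / 8]. *)
destruct (log_slope_lt_near_0 nu w Hw ((3 * Rabs nu + 1) / 4))
  as (d & Hd & HY); [lra|].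
exists d; split; [exact Hd|]; intros a b Ha Hab Hb.
apply (lt_of_derive_pos _ _ a b Hab
         (fun t Ht => derive_ratio nu w Hw t ltac:(lra))).
intros t Ht; assert (Pt : 0 < t) by lra.
generalize (HY t ltac:(lra)) (log_slope_gt_abs nu w Hw t Pt)
  (sol_pos nu w Hw t Pt) (Rabs_pos nu); intros H1 H2 Pw Pn.
apply Rdiv_lt_0_compat.
- rewrite <- (pow2_abs nu).
  assert (0 < t ^ 2) by now apply pow_lt.
  set (n := Rabs nu) in *; set (y := log_slope w t) in *.
  nra.
- apply Rmult_lt_0_compat; [now apply pow_lt|exact Pw].
Qed.

Theorem theorem5p3 (K : R -> R -> R) (HK : is_besselK K) (nu : R) :
  (strictly_decreasing_on (fun u => 0 < u) (g K nu) <-> 1 <= Rabs nu) /\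
  (Rabs nu < 1 ->
     (exists delta : R, 0 < delta /\
        strictly_increasing_on (fun u => 0 < u < delta) (g K nu)) /\
     (exists M : R, 0 < M /\
        strictly_decreasing_on (fun u => M < u) (g K nu)) /\
     ~ monotone_on (fun u => 0 < u) (g K nu)).
Proof.
assert (Hw := besselK_decaying K HK nu).
assert (Hinc := ratio_increasing_near_0 nu (K nu) Hw).
assert (Hdec : forall a b, 1 < a -> a < b -> g K nu b < g K nu a).
{ intros a b Ha Hab; apply (ratio_decreasing nu); [assumption|lra| |lra].
  generalize (pow2_ge_0 nu); nra. }
split; [split|].
- intros Hmon; apply Rnot_lt_le; intros Hnu.
  destruct (Hinc Hnu) as (d & Hd & H).
  specialize (H (d / 3) (d / 2) ltac:(lra) ltac:(lra) ltac:(lra)).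
  specialize (Hmon (d / 3) (d / 2) ltac:(lra) ltac:(lra) ltac:(lra)).
  unfold g in Hmon; lra.
- intros Hnu a b Ha Hb Hab; apply (ratio_decreasing nu); auto.
  rewrite <- (pow2_abs nu); generalize (pow2_ge_0 a); nra.
- intros Hnu; destruct (Hinc Hnu) as (d & Hd & H).
  split; [|split].
  + exists d; split; [exact Hd|].
    intros a b Ha Hb Hab; apply H; lra.
  + exists 1; split; [lra|]; intros a b Ha Hb Hab; now apply Hdec.
  + intros [Hm|Hm].
    * specialize (Hm 2 3 ltac:(lra) ltac:(lra) ltac:(lra)).
      specialize (Hdec 2 3 ltac:(lra) ltac:(lra)); lra.
    * specialize (H (d / 3) (d / 2) ltac:(lra) ltac:(lra) ltac:(lra)).
      specialize (Hm (d / 3) (d / 2) ltac:(lra) ltac:(lra) ltac:(lra)).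
      unfold g in Hm; lra.
Qed.
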